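(* Let $G$ be a countably infinite group with identity $e$ such that for each $g\in G\setminus\{e\}$ the set $\{x\in G:x^2=g\}$ is finite. Then there exists a sequence $(X_n)_{n\in\mathbb{Z}}$ of subsets of $G$ such that $\Delta(X_n)=X_{n+1}$ for all $n\in\mathbb{Z}$ and $X_m\cap X_n=\{e\}$ for all distinct $m,n\in\mathbb{Z}$.
   Context: For $X\subseteq G$, $\Delta(X)=\{g\in G:|gX\cap X|=\infty\}$. *)

(* Defs.v *)
From mathcomp Require Import all_boot all_order all_algebra all_fingroup.
From mathcomp Require Import all_classical.

Set Implicit Arguments.
Unset Strict Implicit.
Unset Printing Implicit Defensive.

Local Open Scope classical_set_scope.
Local Open Scope group_scope.

Definition ltranslate (G : groupType) (g : G) (X : set G) : set G :=
  [set g * x | x in X].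

Definition Delta (G : groupType) (X : set G) : set G :=
  [set g : G | infinite_set (ltranslate g X `&` X)].

(* Main.v *)
Require Import Defs.
From mathcomp Require Import all_boot all_order all_algebra all_fingroup.
From mathcomp Require Import all_classical.

Local Open Scope classical_set_scope.
Local Open Scope group_scope.

(** All the sets X_n are built at once as increasing unions of finite sets,
    starting from X_n = {1}.  Tasks (n, g) are visited infinitely often each;
    when g already lies in X_(n+1), a quadruple {x, g x, x^-1, (g x)^-1} with x
    generic is added to X_n, so that eventually g is in Delta(X_n).  Genericity
    means that no new element is old, and that among quotients a b^-1 involving
    a new element only 1, g and g^-1 may fall in the k-th member of a fixed
    exhaustion of G by finite sets; hence every h outside X_(n+1) is the
    quotient of only finitely many pairs in X_n.  Finiteness of square roots
    handles all quotients of two new elements except the conjugate x^-1 g x,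
    for which x is chosen in the centralizer of g if that is infinite. *)

(** The 2-adic valuation takes each value at arbitrarily large integers, so decoding the valuation
    of [j] through [f] visits every [p] infinitely often; [t0] fills in for valuations outside the
    range of [f]. *)
Lemma recurrent_enumeration (T : choiceType) (t0 : T) (f : T -> nat) :
  injective f ->
  exists t : nat -> T, forall p k, exists2 j, (k <= j)%N & t j = p.
Proof.
move=> finj; exists (fun j => xget t0 [set p | f p = logn 2 j]) => p k.
exists (2 ^ f p * k.*2.+1)%N.
  rewrite (@leq_trans k.*2.+1)//; first by rewrite -addnn leqW ?leq_addr.
  by rewrite leq_pmull// expn_gt0.
have -> : logn 2 (2 ^ f p * k.*2.+1) = f p.
  rewrite lognM ?expn_gt0// pfactorK// lognE/= dvdn2/= odd_double/=.
  by rewrite addn0.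
apply: finj.
by have /= -> := xgetPex t0 (ex_intro (fun q => f q = f p) p erefl).
Qed.

(** * Existence of generic elements *)

Lemma finite_sqrt (G : groupType)
    (Gsqrt : forall g : G, g <> 1 -> finite_set [set x : G | x ^+ 2 = g])
    (S : set G) :
  finite_set S -> ~ S 1 -> finite_set [set x | S (x ^+ 2)].
Proof.
move=> Sfin S1.
apply: (@sub_finite_set _ _ (\bigcup_(g in S) [set x : G | x ^+ 2 = g])).
  by move=> x Sx; exists (x ^+ 2).
by apply: bigcup_finite => // g Sg; apply: Gsqrt => g1; apply: S1; rewrite -g1.
Qed.

Definition symquad (G : groupType) (g x : G) : seq G :=
  [:: x; g * x; x^-1; (g * x)^-1].

(* Only pairs inside the quadruple occur here: the set F used later, [avoid],
   also contains all h * b with b old, which controls the mixed quotients. *)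
Definition generic (G : groupType) (g : G) (F : set G) (x : G) :=
  forall a, a \in symquad G g x -> ~ F a /\
    forall b, b \in symquad G g x ->
      F (a * b^-1) -> a * b^-1 \in [:: 1; g; g^-1].

(** The fibres of [x |-> x^-1 * g * x] are right cosets of the centralizer of [g]. If it is finite,
    [D] is all of [G]; if not, [D] is the centralizer itself, on which the conjugate is constantly
    [g]. *)
Lemma conj_sparse (G : groupType) (Ginf : infinite_set [set: G])
    (g : G) (F : set G) :
  finite_set F ->
  exists2 D : set G, infinite_set D &
    finite_set (D `&` [set x | F (x^-1 * g * x) /\ x^-1 * g * x != g]).
Proof.
move=> Ffin; have [Cfin|Cinf] := pselect (finite_set [set x : G | g * x = x * g]).
- exists setT => //.
  apply: (@sub_finite_set _ _
    (\bigcup_(f in F) [set x : G | x^-1 * g * x = f])).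
    by move=> x [_ [Fx _]]; exists (x^-1 * g * x).
  apply: bigcup_finite => // f _.
  have [[x0 /= x0f]|nx] := pselect (exists x, x^-1 * g * x = f); last first.
    apply: (@sub_finite_set _ _ set0); last exact: finite_set0.
    by move=> x /= xf; apply: nx; exists x.
  apply: (@sub_finite_set _ _ [set z * x0 | z in [set x : G | g * x = x * g]]);
    last exact: finite_image.
  move=> x /= xf; exists (x * x0^-1); last by rewrite mulgVK.
  have gx : g * x = x * f by rewrite -xf !mulgA mulgV mul1g.
  by rewrite mulgA gx -x0f -!mulgA mulgV mulg1.
- exists [set x : G | g * x = x * g] => //.
  apply: (@sub_finite_set _ _ set0); last exact: finite_set0.
  by move=> x [/= cx [_]]; rewrite -mulgA cx mulKg eqxx.
Qed.

Lemma exists_generic (G : groupType) (Ginf : infinite_set [set: G])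
    (Gsqrt : forall g : G, g <> 1 -> finite_set [set x : G | x ^+ 2 = g])
    (g : G) (F : set G) :
  finite_set F -> exists x, generic G g F x.
Proof.
move=> Ffin.
pose E : set G := F `|` [set x^-1 | x in F].
have Efin : finite_set E by rewrite finite_setU; split=> //; exact: finite_image.
have EV z : E z^-1 -> E z.
  case=> [Fz|[y Fy yz]]; first by right; exists z^-1; rewrite ?invgK.
  by left; rewrite -(invg_inj yz).
have finpre (h : G -> G) (B : set G) :
    injective h -> finite_set B -> finite_set (h @^-1` B).
  by move=> hinj; apply: finite_preimage => x y _ _; exact: hinj.
have gI : injective (fun x => g * x) by exact: mulgI.
have gVI : injective (fun x => g^-1 * x) by exact: mulgI.
have [D Dinf Dfin] := conj_sparse G Ginf g E Efin.
(* The sets [B1] to [B5] collect the bad [x]: [x] or [g * x] in [E], then bad values of [x^2],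
   [(g * x)^2], [g * x^2] and [x * g * x = g^-1 * (g * x)^2]. The values [1], [1], [g], [g^-1] are
   spared because there the square is [1], whose roots may be infinitely many; hence the three
   exceptions in [generic]. *)
pose B1 := E `|` (fun x => g * x) @^-1` E.
pose B2 := [set x : G | (E `\ 1) (x ^+ 2)].
pose B3 := (fun x => g * x) @^-1` B2.
pose B4 := [set x : G | ((fun x => g * x) @^-1` (E `\ g)) (x ^+ 2)].
pose B5 := (fun x => g * x) @^-1`
  [set x : G | ((fun x => g^-1 * x) @^-1` (E `\ g^-1)) (x ^+ 2)].
have B1fin : finite_set B1 by rewrite finite_setU; split=> //; exact: finpre.
have B2fin : finite_set B2.
  by apply: finite_sqrt => //; [exact: finite_setD|case=> _; apply].
have B3fin : finite_set B3 by exact: finpre.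
have B4fin : finite_set B4.
  apply: finite_sqrt => //; last by rewrite /= mulg1 => -[_]; apply.
  by apply: finpre => //; exact: finite_setD.
have B5fin : finite_set B5.
  apply: (finpre) => //.
  apply: finite_sqrt => //; last by rewrite /= mulg1 => -[_]; apply.
  by apply: finpre => //; exact: finite_setD.
have := infinite_setD Dinf Dfin.
move=> /infinite_setD /(_ B1fin) /infinite_setD /(_ B2fin).
move=> /infinite_setD /(_ B3fin) /infinite_setD /(_ B4fin).
move=> /infinite_setD /(_ B5fin) /infinite_setN0.
move=> [x [[[[[[Dx nconj] n1] n2] n3] n4] n5]].
have FE z : F z -> E z by left.
have nEx : ~ E x by move=> Ex; apply: n1; left.
have nEgx : ~ E (g * x) by move=> Ex; apply: n1; right.
have sq z : E z -> z = 1 \/ (E `\ 1) z.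
  by move=> Ez; have [|] := eqVneq z 1; [left|right; split=> //; exact/eqP].
have Exx : E (x * x) -> x * x = 1.
  by move=> /sq[//|xx1]; case: n2; rewrite /B2/= expg2.
have Egxgx : E (g * x * (g * x)) -> g * x * (g * x) = 1.
  by move=> /sq[//|xx1]; case: n3; rewrite /B3/B2/= expg2.
have Egxx : E (g * x * x) -> g * x * x = g.
  move=> Ez; apply: contrapT => zg; case: n4.
  by rewrite /B4/= expg2 mulgA; split.
have Exgx : E (x * (g * x)) -> x * (g * x) = g^-1.
  move=> Ez; apply: contrapT => zg; case: n5.
  by rewrite /B5/= expg2 -!mulgA mulKg; split.
have Ecj : E (x^-1 * (g * x)) -> x^-1 * (g * x) = g.
  rewrite mulgA => Ez; apply: contrapT => /eqP zg; case: nconj.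
  by split=> //; split.
exists x => a aq; split.
  move=> /FE; move: aq; rewrite !inE => /or4P[] /eqP -> //; first by move/EV.
  by move/EV.
move=> b bq /FE; rewrite !inE.
(* Each of the sixteen quotients is identically [1], [g] or [g^-1], or is up to inversion one of the
   five words treated above. *)
move: aq bq; rewrite !inE => /or4P[] /eqP -> /or4P[] /eqP ->; rewrite ?invgK.
- by rewrite mulgV eqxx.
- by rewrite invgM mulKVg eqxx !orbT.
- by move=> /Exx ->; rewrite eqxx.
- by move=> /Exgx ->; rewrite eqxx !orbT.
- by rewrite mulgK eqxx !orbT.
- by rewrite mulgV eqxx.
- by move=> /Egxx ->; rewrite eqxx !orbT.
- by move=> /Egxgx ->; rewrite eqxx.
- by rewrite -invgM => /EV/Exx ->; rewrite invg1 eqxx.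
- by rewrite -invgM => /EV/Egxx ->; rewrite eqxx !orbT.
- by rewrite mulVg eqxx.
- by move=> /Ecj ->; rewrite eqxx !orbT.
- by rewrite -invgM => /EV/Exgx ->; rewrite invgK eqxx !orbT.
- by rewrite -invgM => /EV/Egxgx ->; rewrite invg1 eqxx.
- have -> : (g * x)^-1 * x = (x^-1 * (g * x))^-1 by rewrite [RHS]invgM invgK.
  by move=> /EV/Ecj ->; rewrite eqxx !orbT.
- by rewrite mulVg eqxx.
Qed.

(** * The finite stages of the construction *)

Definition layer (G : groupType) (s : seq (int * G)) (n : int) : set G :=
  [set x | x = 1 \/ (n, x) \in s].

(** Here [h = 1] yields [1] and the old elements of all layers, which keeps distinct layers apart,
    and [b = 1] yields the finite set of group elements that quotients must avoid. *)
Definition avoid (G : groupType) (e : G -> nat) (k : nat)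
    (s : seq (int * G)) : set G :=
  [set h * b | h in [set h | [\/ h = 1, (e h <= k)%N | (e h^-1 <= k)%N]]
             & b in [set` 1 :: [seq p.2 | p <- s]]].

Definition extend (G : groupType) (e : G -> nat) (k : nat) (p : int * G)
    (s : seq (int * G)) : seq (int * G) :=
  if `[< layer G s (p.1 + 1)%R p.2 >] then
    s ++ [seq (p.1, a) | a <- symquad G p.2
                                (xget 1 (generic G p.2 (avoid G e k s)))]
  else s.

Fixpoint stage (G : groupType) (e : G -> nat) (t : nat -> int * G) (k : nat) :
    seq (int * G) :=
  if k is j.+1 then extend G e j (t j) (stage G e t j) else [::].

Lemma symquadV (G : groupType) (g x a : G) :
  a \in symquad G g x -> a^-1 \in symquad G g x.
Proof. by rewrite !inE => /or4P[] /eqP ->; rewrite ?invgK eqxx ?orbT. Qed.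

Lemma avoid_finite (G : groupType) (e : G -> nat) (k : nat) s :
  injective e -> finite_set (avoid G e k s).
Proof.
move=> einj; apply: finite_image2; last exact: finite_seq.
have efin : finite_set [set h | (e h <= k)%N].
  apply: (@finite_preimage _ _ [set i | (i <= k)%N] e).
    by move=> x y _ _; exact: einj.
  apply: (@sub_finite_set _ _ `I_k.+1) => [i /=|]; last exact: finite_II.
  by rewrite ltnS.
apply: (@sub_finite_set _ _ ([set 1] `|` ([set h | (e h <= k)%N] `|`
    (fun h => h^-1) @^-1` [set h | (e h <= k)%N]))).
  by move=> h [->|hk|hk]; [left|right; left|right; right].
rewrite !finite_setU; split; first exact: finite_set1.
by split=> //; apply: finite_preimage => // x y _ _; exact: invg_inj.
Qed.

Lemma extendP (G : groupType) (Ginf : infinite_set [set: G])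
    (Gsqrt : forall g : G, g <> 1 -> finite_set [set x : G | x ^+ 2 = g])
    (e : G -> nat) (einj : injective e) k p s :
  layer G s (p.1 + 1)%R p.2 ->
  exists2 x, generic G p.2 (avoid G e k s) x &
    forall n a, (n, a) \in extend G e k p s =
      ((n, a) \in s) || (n == p.1) && (a \in symquad G p.2 x).
Proof.
move=> act.
exists (xget 1 (generic G p.2 (avoid G e k s))).
  by apply: (xgetPex 1); apply: exists_generic => //; exact: avoid_finite.
move=> n a; rewrite /extend asboolT// mem_cat; congr (_ || _).
set q := symquad _ _ _.
apply/mapP/andP => [[b bq [-> ->]]|[/eqP -> aq]]; first by rewrite eqxx.
by exists a.
Qed.

Lemma generic_new (G : groupType) (e : G -> nat) k s (g x a : G) :
  generic G g (avoid G e k s) x -> a \in symquad G g x ->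
  a <> 1 /\ forall n, (n, a) \notin s.
Proof.
move=> gx /gx[na _]; split=> [a1|n].
  by apply: na; exists 1; [exact: Or31|exists 1; rewrite /= ?inE ?eqxx ?mul1g].
apply/negP => as_; apply: na; exists 1; first exact: Or31.
exists a; last by rewrite mul1g.
by rewrite /= inE; apply/orP; right; apply/mapP; exists (n, a).
Qed.

Section Stages.
Variables (G : groupType) (Ginf : infinite_set [set: G])
  (Gsqrt : forall g : G, g <> 1 -> finite_set [set x : G | x ^+ 2 = g])
  (e : G -> nat) (einj : injective e) (t : nat -> int * G).

Local Notation S := (stage G e t).

Lemma stageP k :
  S k.+1 = S k \/
  exists g x, [/\ layer G (S k) ((t k).1 + 1)%R g,
    generic G g (avoid G e k (S k)) x &
    forall n a, (n, a) \in S k.+1 =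
      ((n, a) \in S k) || (n == (t k).1) && (a \in symquad G g x)].
Proof.
have [act|nact] := pselect (layer G (S k) ((t k).1 + 1)%R (t k).2).
  have [x gx ext] := extendP G Ginf Gsqrt e einj k (t k) (S k) act.
  by right; exists (t k).2, x.
by left; rewrite /= /extend asboolF.
Qed.

Lemma stage_mono j k p : (j <= k)%N -> p \in S j -> p \in S k.
Proof.
move=> /subnKC <-; elim: (k - j)%N => [|i IH]; first by rewrite addn0.
move=> /IH {IH}; rewrite addnS; have [->//|[g [x [_ _ ext]]]] := stageP (j + i).
by case: p => n a pS; rewrite ext pS.
Qed.

Lemma layer_mono j k n x : (j <= k)%N ->
  layer G (S j) n x -> layer G (S k) n x.
Proof. by move=> jk [->|/(stage_mono _ _ _ jk)]; [left|right]. Qed.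

(** Needed because a quadruple added for [g] also creates the quotient [g^-1], which must then lie
    in the same layer as [g]. *)
Lemma stageV k n x : (n, x) \in S k -> (n, x^-1) \in S k.
Proof.
elim: k => // k IH; have [->//|[g [y [_ _ ext]]]] := stageP k.
rewrite !ext => /orP[/IH ->//|/andP[-> /symquadV ->]].
by rewrite orbT.
Qed.

Lemma stage_disjoint k m n x : (m, x) \in S k -> (n, x) \in S k -> m = n.
Proof.
elim: k => // k IH; have [->//|[g [y [_ gen ext]]]] := stageP k.
rewrite !ext => /orP[mS|/andP[/eqP -> xq]] /orP[nS|/andP[/eqP -> xq']] //.
- exact: IH.
- by have [_ /(_ m)] := generic_new G e _ _ _ _ _ gen xq'; rewrite mS.
- by have [_ /(_ n)] := generic_new G e _ _ _ _ _ gen xq; rewrite nS.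
Qed.

(** Once the stage number reaches [e h], genericity forbids new pairs with quotient [h] unless [h]
    is in layer [n + 1]; so all such pairs in layer [n] are already present at stage [j]. *)
Lemma stage_pair j k n h a : (e h <= j)%N -> (j <= k)%N ->
  (forall i, ~ layer G (S i) (n + 1)%R h) ->
  layer G (S k) n a -> layer G (S k) n (h * a) ->
  layer G (S j) n (h * a).
Proof.
move=> hj /subnKC <- nh; elim: (k - j)%N a => [|i IH] a; first by rewrite addn0.
rewrite addnS; move: IH; set l := (j + i)%N => IH.
have hl : (e h <= l)%N by rewrite (leq_trans hj)// leq_addr.
have [->|[g [x [act gen ext]]]] := stageP l; first exact: IH.
have gact : forall m, m = (t l).1 -> layer G (S l) (m + 1)%R g^-1.
  by move=> m ->; case: act => [->|/stageV]; [left; rewrite invg1|right].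
have old b : layer G (S l) n b -> b \in 1 :: [seq p.2 | p <- S l].
  move=> [->|bS]; rewrite inE ?eqxx//; apply/orP; right.
  by apply/mapP; exists (n, b).
have split b : layer G (S l.+1) n b ->
    layer G (S l) n b \/ n = (t l).1 /\ b \in symquad G g x.
  move=> [->|]; first by left; left.
  by rewrite ext => /orP[?|/andP[/eqP ? ?]]; [left; right|right].
(* If just one of [a], [h * a] is new, it is [h] or [h^-1] times an old element, hence in [avoid].
   If both are new, their quotient [h] is [1], [g] or [g^-1], all members of layer [n + 1]. *)
move=> /split[la|[nt aq]] /split[lb|[nt' bq]].
- exact: IH la lb.
- have [[]] := gen _ bq; exists h; first exact: Or32.
  by exists a => //; exact: old.
- have [[]] := gen _ aq; exists h^-1; first by apply: Or33; rewrite invgK.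
  by exists (h * a); [exact: old|rewrite mulKg].
- case: (nh l); have [_ /(_ _ aq)] := gen _ bq.
  rewrite mulgK => dich; have /dich : avoid G e l (S l) h.
    exists h; first exact: Or32.
    by exists 1; rewrite ?mulg1//= inE eqxx.
  rewrite !inE => /or3P[] /eqP ->; first by left.
    by rewrite nt.
  exact: gact.
Qed.

Hypothesis trec : forall p k, exists2 j, (k <= j)%N & t j = p.

(** A visit of the task [(n, h)] after stages [i] and [k] adds [x] and [y = h * x], both fresh. *)
Lemma stage_new_pair i k n h : layer G (S i) (n + 1)%R h ->
  exists y j, [/\ ~ layer G (S k) n y, layer G (S j) n y &
    layer G (S j) n (h^-1 * y)].
Proof.
move=> lh; have [j ijk tj] := trec (n, h) (maxn i k).
have [ij kj] : (i <= j)%N /\ (k <= j)%N by apply/andP; rewrite -geq_max.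
have act : layer G (S j) ((t j).1 + 1)%R (t j).2.
  by rewrite tj; exact: layer_mono lh.
have [x gen ext] := extendP G Ginf Gsqrt e einj j (t j) (S j) act.
rewrite tj/= in gen ext.
have xq : x \in symquad G h x by rewrite inE eqxx.
have hxq : h * x \in symquad G h x by rewrite !inE eqxx orbT.
exists (h * x), j.+1; split.
- have [n1 nS] := generic_new G e _ _ _ _ _ gen hxq.
  move=> /(layer_mono _ _ _ _ kj) [//|].
  by move: (nS n) => /negP.
- by right; rewrite /= tj ext eqxx hxq orbT.
- by right; rewrite /= tj ext eqxx mulKg xq orbT.
Qed.

(** * The limit sets and their properties *)

Definition limit_layer (n : int) : set G := \bigcup_k layer G (S k) n.

Lemma limit_layer_finite (A : set G) n : finite_set A ->
  A `<=` limit_layer n -> exists k, A `<=` layer G (S k) n.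
Proof.
move=> /finite_seqP[s ->]; elim: s => [|a s IH] sub; first by exists 0.
have [k sk] : exists k, [set` s] `<=` layer G (S k) n.
  by apply: IH => y /= ys; apply: sub; rewrite /= inE ys orbT.
have [j _ aj] : limit_layer n a by apply: sub; rewrite /= inE eqxx.
exists (maxn j k) => y /=; rewrite inE => /orP[/eqP ->|/sk].
  by apply: layer_mono aj; exact: leq_maxl.
by apply: layer_mono; exact: leq_maxr.
Qed.

Lemma Delta_limit_layer n : Delta (limit_layer n) = limit_layer (n + 1)%R.
Proof.
apply/seteqP; split=> h /=.
- move=> hinf; apply: contrapT => nh; apply: hinf.
  have {}nh i : ~ layer G (S i) (n + 1)%R h by move=> li; apply: nh; exists i.
  (* For [h] outside layer [n + 1], the whole intersection is confined to the finite stage [e h]. *)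
  apply: (@sub_finite_set _ _ (layer G (S (e h)) n)).
    move=> _ [[a [i _ la] <-] [j _ lha]].
    apply: (stage_pair (e h) (maxn (e h) (maxn i j)) n h a) => //.
    + exact: leq_maxl.
    + by apply: layer_mono la; rewrite maxnCA leq_maxl.
    + by apply: layer_mono lha; rewrite !maxnA leq_maxr.
  apply: (@sub_finite_set _ _ [set` 1 :: [seq p.2 | p <- S (e h)]]);
    last exact: finite_seq.
  move=> a [->|aS] /=; rewrite inE ?eqxx//; apply/orP; right.
  by apply/mapP; exists (n, a).
- move=> [i _ lh] fin.
  (* A finite intersection would sit inside a single stage [k], which the element [y] created later
     escapes. *)
  have [|k sub] := limit_layer_finite _ n fin; first by move=> y [].
  have [y [j [ny ly lhy]]] := stage_new_pair i k n h lh.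
  apply: ny; apply: sub; split; last by exists j.
  by exists (h^-1 * y); [exists j|rewrite mulKVg].
Qed.

Lemma limit_layer_disjoint m n : m <> n ->
  limit_layer m `&` limit_layer n = [set 1].
Proof.
move=> mn; apply/seteqP; split=> [x|_ ->]; last by split; exists 0 => //; left.
move=> [[i _ [//|mi]] [j _ [//|nj]]]; case: mn.
apply: (stage_disjoint (maxn i j) m n x).
  by apply: stage_mono mi; exact: leq_maxl.
by apply: stage_mono nj; exact: leq_maxr.
Qed.

End Stages.

Theorem theorem5p4 (G : groupType)
    (Gcount : countable [set: G]) (Ginf : infinite_set [set: G])
    (Gsqrt : forall g : G, g <> 1 -> finite_set [set x : G | x ^+ 2 = g]) :
  exists X : int -> set G,
    (forall n : int, Delta (X n) = X (n + 1)%R) /\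
    (forall m n : int, m <> n -> X m `&` X n = [set 1]).
Proof.
have [e einj0] := countable_injP _ Gcount.
have einj : injective e by move=> x y; apply: einj0; exact: in_setT.
have [|t trec] := recurrent_enumeration (int * G)%type (0%R, 1)
  (fun p => pickle (p.1, e p.2)).
  by move=> [m x] [n y] /(pcan_inj pickleK) [-> /einj ->].
exists (limit_layer G e t); split.
  exact: Delta_limit_layer.
exact: limit_layer_disjoint.
Qed.
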